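(* Let $n\in\mathbb{N}$ and $k,s\in\mathbb{Z}_{\geq 0}$ with $n>k$, and let $\zeta_n$ be a fixed primitive $n$-th root of unity. Then the following two statements are equivalent: (i) for any $d_0,d_1,\ldots,d_s\in\mathbb{Z}_{\geq 0}$ with $3\sum_{j=0}^{s}d_j=k-4s$, it holds $$C_n^3(d_0,d_1,\ldots,d_s)=\frac{(-1)^s}{n^3}\left[\binom{n+k-d+2}{k+3}+(-1)^{d-s}\binom{n+d}{k+3}+A(n,d-s,s)\right](1-\zeta_n)^k,$$ where $d=\sum_{j=0}^s d_j+s$; (ii) for any $d_0,\ldots,d_s,d_0',\ldots,d_s'\in\mathbb{Z}_{\geq 0}$ with $3\sum_{j=0}^{s}d_j=3\sum_{j=0}^{s}d_j'=k-4s$, it holds $$C_n^3(d_0,d_1,\ldots,d_s)=C_n^3(d_0',d_1',\ldots,d_s').$$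
   Context: $\mathbb{N}$ is the set of positive integers. For $n\in\mathbb{N}$, a complex number $q$ with $q^m\neq 1$ for all $m\in\mathbb{N}$ with $m<n$, and a multi-index $(k_1,\ldots,k_d)\in\mathbb{N}^d$, the finite multiple harmonic $q$-series is $$z_n(k_1,\ldots,k_d;q)=\sum_{n>m_1>\cdots>m_d>0}\frac{q^{(k_1-1)m_1+\cdots+(k_d-1)m_d}}{[m_1]^{k_1}\cdots[m_d]^{k_d}},\qquad [m]=\frac{1-q^m}{1-q},$$ where $m_1,\dots,m_d$ are integers. An empty sum is $0$, and for the empty multi-index ($d=0$) one sets $z_n(\emptyset;q)=1$. The notation $\{a\}^{m}$ means $a$ repeated $m$ times. For $r\in\mathbb{N}$ and $s,d_0,\ldots,d_s\in\mathbb{Z}_{\geq 0}$ the cyclic sum is $$C_n^r(d_0,d_1,\ldots,d_s)=\sum_{j=0}^{s}z_n\left(\{r\}^{d_j},r+1,\{r\}^{d_{j+1}},r+1,\ldots,r+1,\{r\}^{d_{j+s}};\zeta_n\right),$$ where indices of $d$ are read modulo $s+1$ (so $d_j=d_i$ if $j\equiv i$ modulo $s+1$), and in each term the entry $r+1$ occurs exactly $s$ times. Here $r=3$. For $n\in\mathbb{N}$ and $l,s\in\mathbb{Z}_{\ge 0}$, $$A(n,l,s)=\sum_{i=1}^{s+l+1}\frac{-(s+1)}{i\binom{s+l}{l}}\binom{i}{s+l+1-i}\sum_{j=0}^{2i-s-l-1}(-4)^{j}\binom{2i-s-l-1}{j}\binom{n+2s+2l+1-i+j}{4s+4l+3-2i+2j}\binom{2s+2l+2-2i}{s+1-j},$$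 where the inner sum is $0$ when $2i-s-l-1<0$. Binomial coefficients $\binom{a}{b}$ with integers $a\ge 0$ are $0$ if $b<0$ or $b>a$; $0^0=1$. *)

(* Defs.v *)
From mathcomp Require Import all_boot all_order all_algebra.
From mathcomp Require Import reals complex.
Set Implicit Arguments.
Unset Strict Implicit.
Unset Printing Implicit Defensive.
Import GRing.Theory.
Local Open Scope ring_scope.

Section MultipleHarmonicQSeries.
Variable F : fieldType.

Definition qint (q : F) (m : nat) : F := (1 - q ^+ m) / (1 - q).

(* The tuple m = (m_1, ..., m_d) ranges over n > m_1 > ... > m_d > 0, which is
   exactly what [path gtn n (rcons m 0)] expresses.  For [ks = [::]] and n > 0
   the only term is the empty product, so the value is 1. *)
Definition zq (n : nat) (ks : seq nat) (q : F) : F :=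
  \sum_(m : (size ks).-tuple 'I_n
        | path gtn n (rcons [seq val x | x <- m] 0%N))
    \prod_(i < size ks)
      (q ^+ ((nth 0%N ks i).-1 * tnth m i)%N / qint q (tnth m i) ^+ nth 0%N ks i).

(* The multi-index {r}^{d_j}, r+1, {r}^{d_{j+1}}, r+1, ..., r+1, {r}^{d_{j+s}};
   [j + i] is addition in 'I_s.+1, that is, modulo s+1. *)
Definition cyc_index (r s : nat) (d : 'I_s.+1 -> nat) (j : 'I_s.+1) : seq nat :=
  nseq (d j) r
    ++ flatten [seq r.+1 :: nseq (d (j + inZp i)) r | i <- iota 1 s].

Definition cyclic_sum (r n s : nat) (d : 'I_s.+1 -> nat) (q : F) : F :=
  \sum_(j < s.+1) zq n (cyc_index r d j) q.

End MultipleHarmonicQSeries.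

(* Natural subtraction is harmless here: s + l + 1 - i >= 0 in the range of i;
   the range j < 2i - (s + l) is 0 <= j <= 2i - s - l - 1 and is empty when
   2i - s - l - 1 < 0; the other differences are >= 0 on these ranges, except
   s + 1 - j, where the test j <= s + 1 makes the binomial coefficient vanish
   when its lower argument is negative. *)
Definition A (n l s : nat) : rat :=
  \sum_(1 <= i < (s + l + 1).+1)
    - (s + 1)%:R / (i * 'C(s + l, l))%:R * 'C(i, s + l + 1 - i)%:R
    * \sum_(0 <= j < 2 * i - (s + l))
        (-4) ^+ j * 'C(2 * i - s - l - 1, j)%:R
        * 'C(n + 2 * s + 2 * l + 1 - i + j,
             4 * s + 4 * l + 3 - 2 * i + 2 * j)%:R
        * (if (j <= s + 1)%N
           then 'C(2 * s + 2 * l + 2 - 2 * i, s + 1 - j)%:R else 0).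

(* Main.v *)
(** Averaging the cyclic sum over all (d_0, ..., d_s) of sum l gives (s+1) times
    the sum of z_n over all words with l letters 3 and s letters 4, so constancy
    of the cyclic sum is equivalent to a closed formula once that sum is known.
    Up to (1-w)^k, it is the coefficient of x^l y^s in
      prod_{0<m<n} (1 + x w^{2m}/(1-w^m)^3 + y w^{3m}/(1-w^m)^4)
        = n^{-4} y^{-1} prod_{z^n=1} H(z),
    where H(z) = (1-z)^4 + x(1-z)z^2 + y z^3 = prod_i (z - b_i).
    Since b_1 b_2 b_3 b_4 = 1, prod_{z^n=1} H(z) = prod_i (1 - b_i^n) equals
    2 - p_n(b_i) - p_n(b_i b_j b_k) + p_n(b_i b_j), with p_n the n-th power sum.
    Each power sum is read off from -log prod (1 - c t) = sum_n p_n t^n / n; the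
    first two give the two binomial terms of the formula and the last gives A. *)

Require Import Defs.
From mathcomp Require Import all_boot all_order all_algebra.
From mathcomp Require Import ring zify.
From mathcomp Require Import reals complex.
Import Order.TTheory GRing.Theory Num.Theory.
Local Open Scope ring_scope.
Set Implicit Arguments.
Unset Strict Implicit.
Unset Printing Implicit Defensive.

(** * Polynomial identities from infinitely many values *)

Lemma poly_many_roots_eq0 (D : idomainType) (p : {poly D}) (f : nat -> D) :
  injective f -> (forall i, p.[f i] = 0) -> p = 0.
Proof.
move=> f_inj p0; apply: (@roots_geq_poly_eq0 _ _ (mkseq f (size p))).
- by apply/allP => _ /mapP[i _ ->]; apply/rootP.
- by rewrite map_inj_uniq ?iota_uniq.
- by rewrite size_mkseq.
Qed.

(** The natural numbers are pairwise distinct in a [numFieldType], so vanishing at all of them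
    settles first the outer and then the inner variable. *)
Lemma bipoly_eval_inj (F : numFieldType) (P Q : {poly {poly F}}) :
  (forall u v : F, P.[v%:P].[u] = Q.[v%:P].[u]) -> P = Q.
Proof.
move=> PQ; apply/eqP; rewrite -subr_eq0; apply/eqP.
have inj : injective (fun i : nat => i%:R : F) by move=> i j /eqP; rewrite eqr_nat => /eqP.
apply: (@poly_many_roots_eq0 _ _ (fun i => (i%:R)%:P)) => [i j /polyC_inj/inj //|i].
apply: (@poly_many_roots_eq0 _ _ (fun i => i%:R)) => // j.
by rewrite !(hornerD, hornerN) PQ subrr.
Qed.

(** * Logarithmic derivatives modulo a power of X, and power sums *)

Section LogDerivative.
Variable F : numFieldType.
Implicit Types (A B Y : {poly F}) (r : seq F).

(** The relation A'/A = B modulo X^n, with the denominator cleared to stay within polynomials. *)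
Definition logder n A B := 'X^n %| A^`() - A * B.

Lemma logderM n A1 B1 A2 B2 :
  logder n A1 B1 -> logder n A2 B2 -> logder n (A1 * A2) (B1 + B2).
Proof.
rewrite /logder derivM => h1 h2.
have -> : A1^`() * A2 + A1 * A2^`() - A1 * A2 * (B1 + B2)
  = (A1^`() - A1 * B1) * A2 + A1 * (A2^`() - A2 * B2) by ring.
by apply: dvdp_add; [apply: dvdp_mulr | apply: dvdp_mull].
Qed.

(** [A] has constant term 1, hence is coprime to X^n and can be cancelled from [A * (B - B')].
    Differentiating [A - A'] costs one power of X, whence the exponent n + 1. *)
Lemma logder_inj n A A' B B' :
  A`_0 = 1 -> 'X^(n.+1) %| A - A' -> logder n A B -> logder n A' B' ->
  'X^n %| B - B'.
Proof.
move=> A0 /dvdpP[C AA'] h h'.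
have cA : coprimep 'X^n A.
  case: n {AA' h h'} => [|n]; first by rewrite expr0 coprime1p.
  by rewrite coprimep_expl // coprimep_sym coprimepX rootE horner_coef0 A0 oner_eq0.
rewrite -(Gauss_dvdpr _ cA).
have -> : A * (B - B') = (A'^`() - A' * B') - (A^`() - A * B)
     + ((A - A')^`() - (A - A') * B').
  by rewrite derivB; ring.
apply: dvdp_add; first exact: dvdp_sub.
rewrite AA' derivM derivXn exprS -mulr_natl.
apply/dvdpP; exists (C^`() * 'X + C * (n.+1)%:R - C * 'X * B').
by rewrite /=; ring.
Qed.

Definition geom n (c : F) : {poly F} := \sum_(i < n) (c *: 'X) ^+ i.

Lemma geomE n c : (1 - c *: 'X) * geom n c = 1 - c ^+ n *: 'X^n.
Proof. by rewrite -opprB mulNr -subrX1 exprZn opprB. Qed.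

Lemma coef_geom n c i : (geom n c)`_i = if (i < n)%N then c ^+ i else 0.
Proof.
rewrite /geom (eq_bigr (fun i : 'I_n => c ^+ i *: 'X^i)) => [|j _]; last first.
  by rewrite exprZn.
by rewrite -poly_def coef_poly.
Qed.

(** The logarithmic derivative of 1 - c X is -c/(1 - c X), whose coefficients are the -c^(i+1): this
    is where power sums enter. *)
Lemma logder_prod n r :
  logder n (\prod_(c <- r) (1 - c *: 'X)) (\sum_(c <- r) - (c *: geom n c)).
Proof.
elim: r => [|c r IH]; first by rewrite /logder !big_nil derivC mulr0 subr0 dvdp0.
rewrite !big_cons; apply: logderM => //.
rewrite /logder mulrN opprK -scalerAr geomE scalerBr derivB derivC derivZ derivX.
apply/dvdpP; exists (- (c * c ^+ n)%:P).
by rewrite -!mul_polyC polyCM; ring.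
Qed.

(** Since [Y] has no constant term, X^n divides Y^n, so the finite geometric sum inverts 1 - Y
    modulo X^n. *)
Lemma logder_1sub n Y :
  Y`_0 = 0 -> logder n (1 - Y) (- (Y^`() * \sum_(i < n) Y ^+ i)).
Proof.
move=> Y0; have := subrX1 Y n; move: (\sum_(i < n) _) => S hS.
have /dvdpP[Z YZ] : 'X %| Y by rewrite -['X]subr0 -polyC0 dvdp_XsubCl rootE horner_coef0 Y0.
rewrite /logder derivB derivC.
have -> : 0 - Y^`() - (1 - Y) * - (Y^`() * S) = - (Y^`() * (1 + (Y - 1) * S)) by ring.
rewrite -hS [in Y ^+ n]YZ exprMn -mulrN; apply/dvdpP; exists (- (Y^`() * Z ^+ n)).
by ring.
Qed.

(* Newton's power sums as a truncated logarithm: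
   [- log (\prod_c (1 - c t)) = \sum_n p_n t^n / n]. *)
Lemma power_sumE n r Y : (0 < n)%N -> Y`_0 = 0 ->
  'X^(n.+1) %| \prod_(c <- r) (1 - c *: 'X) - (1 - 'X) ^+ size r * (1 - Y) ->
  \sum_(c <- r) c ^+ n
    = (size r)%:R + n%:R * \sum_(i < n) (Y ^+ i.+1)`_n / i.+1%:R.
Proof.
case: n => // n _ Y0 h.
have P0 : (\prod_(c <- r) (1 - c *: 'X) : {poly F})`_0 = 1.
  rewrite -horner_coef0 horner_prod big1 // => c _.
  by rewrite !hornerE ?mulr0 subr0.
have h1 := logder_prod n.+1 r.
(* The factor (1 - X)^(size r) is the product over a list of ones, whose power sums all equal
   [size r]. *)
have h2 := logderM (logder_prod n.+1 (nseq (size r) 1)) (logder_1sub n.+1 Y0).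
have e1 : \prod_(c <- nseq (size r) 1) (1 - c *: 'X) = (1 - 'X : {poly F}) ^+ size r.
  by rewrite big_nseq scale1r -Monoid.iteropE.
rewrite e1 in h2.
have /dvdpP[Z /(congr1 (fun p : {poly F} => p`_n))] := logder_inj P0 h h1 h2.
rewrite coefMXn ltnSn => /eqP; rewrite coefB subr_eq0 => /eqP.
have e r' : (\sum_(c <- r') - (c *: geom n.+1 c))`_n = - \sum_(c <- r') c ^+ n.+1.
  rewrite coef_sum -sumrN; apply: eq_bigr => c _.
  by rewrite coefN coefZ coef_geom ltnSn -exprS.
rewrite coefD !e coefN big_nseq expr1n -opprD => /oppr_inj ->.
congr (_ + _).
  by rewrite iter_addr addr0.
(* Y' Y^i is the derivative of Y^(i+1)/(i+1), so its coefficient of index n is n + 1 times the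
   coefficient of index n + 1 of Y^(i+1)/(i+1). *)
rewrite mulr_sumr coef_sum mulr_sumr; apply: eq_bigr => i _.
have i0 : (i.+1%:R : F) != 0 by rewrite pnatr_eq0.
rewrite mulrA; apply: (canRL (mulfK i0)).
rewrite [RHS]mulr_natl -coef_deriv deriv_exp /= coefMn mulr_natr.
by congr (_`_n *+ _); rewrite mulrC.
Qed.
End LogDerivative.

(** * Truncated series for the products over roots, triples and pairs of roots *)

Definition ones {A : nzRingType} n : {poly A} := \sum_(i < n) 'X^i.

Lemma onesE (A : nzRingType) n : (1 - 'X) * ones n = 1 - 'X^n :> {poly A}.
Proof. by rewrite -opprB mulNr -subrX1 opprB. Qed.

Section TruncatedSeries.
Variable A : comNzRingType.
Implicit Types x y : A.

(* With [ones] the truncation of [1 / (1 - t)], the products [\prod (1 - c t)] over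
   the roots [b_i] of [H], the [b_i b_j b_k] and the [b_i b_j] are respectively
   [(1 - t)^4 (1 - serR)], [(1 - t)^4 (1 - serT)] and [(1 - t)^6 (1 - serP)]
   modulo [t^(n+1)]. *)
Definition serR n x y : {poly A} :=
  (x%:P * 'X) * ones n.+1 ^+ 3 + ((- y)%:P * 'X) * ones n.+1 ^+ 4.

Definition serT n x y : {poly A} :=
  ((- x)%:P * 'X^2) * ones n.+1 ^+ 3 + ((- y)%:P * 'X^3) * ones n.+1 ^+ 4.

Definition serP n x y : {poly A} :=
  x%:P * 'X * ones n.+1 ^+ 2 + (4 * y)%:P * 'X^2 * ones n.+1 ^+ 4
  + ((x - y) ^+ 2)%:P * 'X^3 * ones n.+1 ^+ 6.

(** The elementary symmetric functions are variables tied by hypotheses, so that their prescribed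
    values enter by rewriting. *)
Lemma prod_roots (t b1 b2 b3 b4 e1 e2 e3 e4 : A) :
  b1 + b2 + b3 + b4 = e1 ->
  b1 * b2 + b1 * b3 + b1 * b4 + b2 * b3 + b2 * b4 + b3 * b4 = e2 ->
  b1 * b2 * b3 + b1 * b2 * b4 + b1 * b3 * b4 + b2 * b3 * b4 = e3 ->
  b1 * b2 * b3 * b4 = e4 ->
  (1 - b1 * t) * (1 - b2 * t) * (1 - b3 * t) * (1 - b4 * t)
  = 1 - e1 * t + e2 * t ^+ 2 - e3 * t ^+ 3 + e4 * t ^+ 4.
Proof. by move=> <- <- <- <-; ring. Qed.

Lemma prod_root_triples (t b1 b2 b3 b4 e1 e2 e3 e4 : A) :
  b1 + b2 + b3 + b4 = e1 ->
  b1 * b2 + b1 * b3 + b1 * b4 + b2 * b3 + b2 * b4 + b3 * b4 = e2 ->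
  b1 * b2 * b3 + b1 * b2 * b4 + b1 * b3 * b4 + b2 * b3 * b4 = e3 ->
  b1 * b2 * b3 * b4 = e4 ->
  (1 - (b1 * b2 * b3) * t) * (1 - (b1 * b2 * b4) * t)
  * (1 - (b1 * b3 * b4) * t) * (1 - (b2 * b3 * b4) * t)
  = 1 - e3 * t + (e2 * e4) * t ^+ 2 - (e1 * e4 ^+ 2) * t ^+ 3
    + e4 ^+ 3 * t ^+ 4.
Proof. by move=> <- <- <- <-; ring. Qed.

Lemma prod_root_pairs (t b1 b2 b3 b4 e1 e2 e3 e4 : A) :
  b1 + b2 + b3 + b4 = e1 ->
  b1 * b2 + b1 * b3 + b1 * b4 + b2 * b3 + b2 * b4 + b3 * b4 = e2 ->
  b1 * b2 * b3 + b1 * b2 * b4 + b1 * b3 * b4 + b2 * b3 * b4 = e3 ->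
  b1 * b2 * b3 * b4 = e4 ->
  (1 - (b1 * b2) * t) * (1 - (b1 * b3) * t) * (1 - (b1 * b4) * t)
  * (1 - (b2 * b3) * t) * (1 - (b2 * b4) * t) * (1 - (b3 * b4) * t)
  = 1 - e2 * t + (e1 * e3 - e4) * t ^+ 2
    - (e3 ^+ 2 + e1 ^+ 2 * e4 - 2 * (e2 * e4)) * t ^+ 3
    + (e4 * (e1 * e3 - e4)) * t ^+ 4 - (e4 ^+ 2 * e2) * t ^+ 5 + e4 ^+ 3 * t ^+ 6.
Proof. by move=> <- <- <- <-; ring. Qed.
End TruncatedSeries.

(** * The product over the n-th roots of unity *)

Section CyclotomicProduct.
Variable F : numClosedFieldType.
Implicit Types x y w : F.

(** The list sizes 4, 4 and 6 in the three power sums cancel the constant 2 of the expanded product: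
    2 - 4 - 4 + 6 = 0. *)
Lemma power_sum_roots n (b1 b2 b3 b4 x y : F) : (0 < n)%N ->
  b1 + b2 + b3 + b4 = 4 + x - y ->
  b1 * b2 + b1 * b3 + b1 * b4 + b2 * b3 + b2 * b4 + b3 * b4 = 6 + x ->
  b1 * b2 * b3 + b1 * b2 * b4 + b1 * b3 * b4 + b2 * b3 * b4 = 4 ->
  b1 * b2 * b3 * b4 = 1 ->
  (1 - b1 ^+ n) * (1 - b2 ^+ n) * (1 - b3 ^+ n) * (1 - b4 ^+ n)
  = n%:R * \sum_(i < n) (serP n x y ^+ i.+1 - serR n x y ^+ i.+1
                         - serT n x y ^+ i.+1)`_n / i.+1%:R.
Proof.
move=> n0 h1 h2 h3 h4.
have := onesE F n.+1; rewrite /serP /serR /serT.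
set U := ones n.+1; set E := 'X^(n.+1) => hU.
(* This turns each divisibility by X^(n+1) below into a polynomial identity in X and [U]. *)
have hE : E = 1 - (1 - 'X) * U by rewrite hU; ring.
have P1 := congr1 (@polyC F) h1; have P2 := congr1 (@polyC F) h2.
have P3 := congr1 (@polyC F) h3; have P4 := congr1 (@polyC F) h4.
rewrite !(rmorphD, rmorphB, rmorphM, rmorph1, rmorph_nat) /= in P1 P2 P3 P4.
have sR : b1 ^+ n + b2 ^+ n + b3 ^+ n + b4 ^+ n =
    4 + n%:R * \sum_(i < n) (serR n x y ^+ i.+1)`_n / i.+1%:R.
  rewrite -(@power_sumE _ n [:: b1; b2; b3; b4]) //.
  - by rewrite !big_cons big_nil; ring.
  - by rewrite -horner_coef0 /serR !(hornerD, hornerM, hornerXn, hornerX); ring.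
  rewrite !big_cons big_nil -/E mulr1 /serR -/U -!mul_polyC !mulrA.
  rewrite (prod_roots _ P1 P2 P3 P4) /=.
  (* The quartic is (1 - X)^4 - x X (1 - X) + y X, and 1 - V^k = X^(n+1) (1 + V + ... + V^(k-1))
     gives the quotient. *)
  pose V : {poly F} := (1 - 'X) * U.
  apply/dvdpP; exists (y%:P * 'X * (1 + V + V ^+ 2 + V ^+ 3)
    - x%:P * 'X * (1 - 'X) * (1 + V + V ^+ 2)).
  by rewrite hE /V; ring.
have sT : (b1 * b2 * b3) ^+ n + (b1 * b2 * b4) ^+ n + (b1 * b3 * b4) ^+ n
    + (b2 * b3 * b4) ^+ n =
    4 + n%:R * \sum_(i < n) (serT n x y ^+ i.+1)`_n / i.+1%:R.
  rewrite -(@power_sumE _ n [:: b1 * b2 * b3; b1 * b2 * b4; b1 * b3 * b4; b2 * b3 * b4]) //.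
  - by rewrite !big_cons big_nil; ring.
  - by rewrite -horner_coef0 /serT !(hornerD, hornerM, hornerXn, hornerX); ring.
  rewrite !big_cons big_nil -/E mulr1 /serT -/U -!mul_polyC !polyCM !mulrA.
  have := prod_root_triples 'X P1 P2 P3 P4; rewrite !mulrA => -> /=.
  (* Here the quartic is (1 - X)^4 + x X^2 (1 - X) + y X^3. *)
  pose V : {poly F} := (1 - 'X) * U.
  apply/dvdpP; exists (x%:P * 'X^2 * (1 - 'X) * (1 + V + V ^+ 2)
    + y%:P * 'X^3 * (1 + V + V ^+ 2 + V ^+ 3)).
  by rewrite hE /V; ring.
have sP : (b1 * b2) ^+ n + (b1 * b3) ^+ n + (b1 * b4) ^+ n
    + (b2 * b3) ^+ n + (b2 * b4) ^+ n + (b3 * b4) ^+ n =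
    6 + n%:R * \sum_(i < n) (serP n x y ^+ i.+1)`_n / i.+1%:R.
  rewrite -(@power_sumE _ n [:: b1 * b2; b1 * b3; b1 * b4; b2 * b3; b2 * b4; b3 * b4]) //.
  - by rewrite !big_cons big_nil; ring.
  - by rewrite -horner_coef0 /serP !(hornerD, hornerM, hornerXn, hornerX); ring.
  rewrite !big_cons big_nil -/E mulr1 /serP -/U -!mul_polyC !polyCM !mulrA.
  have := prod_root_pairs 'X P1 P2 P3 P4; rewrite !mulrA => -> /=.
  (* The sextic is (1 - X)^6 - x X (1 - X)^4 - 4 y X^2 (1 - X)^2 - (x - y)^2 X^3. *)
  pose V : {poly F} := (1 - 'X) * U.
  apply/dvdpP; exists (- x%:P * 'X * (1 - 'X) ^+ 4 * (1 + V)
    - 4 * y%:P * 'X^2 * (1 - 'X) ^+ 2 * (1 + V + V ^+ 2 + V ^+ 3)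
    - (x - y)%:P ^+ 2 * 'X^3 * (1 + V + V ^+ 2 + V ^+ 3 + V ^+ 4 + V ^+ 5)).
  by rewrite hE /V; ring.
under eq_bigr => i _ do rewrite !coefB !mulrBl.
rewrite !sumrB !mulrBr.
move: sR sT sP; rewrite /serR /serT /serP -/U => sR sT sP.
have h4n : (b1 * b2 * b3 * b4) ^+ n = 1 by rewrite h4 expr1n.
set SP := n%:R * _ in sP *; set SR := n%:R * _ in sR *; set ST := n%:R * _ in sT *.
have -> : SP = (SP + 6) - 6 by ring.
have -> : SR = (SR + 4) - 4 by ring.
have -> : ST = (ST + 4) - 4 by ring.
rewrite ![_ + 4]addrC [_ + 6]addrC -sR -sT -sP.
rewrite !exprMn in h4n *.
ring: h4n.
Qed.

Lemma prod_sub_unity_roots n w c :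
  n.-primitive_root w -> \prod_(0 <= m < n) (c - w ^+ m) = c ^+ n - 1.
Proof.
move=> /factor_Xn_sub_1/(congr1 (fun p : {poly F} => p.[c])).
rewrite horner_prod !hornerE => <-.
by apply: eq_bigr => m _; rewrite !hornerE.
Qed.

(** Dividing X^n - 1 by X - 1 leaves 1 + X + ... + X^(n-1), whose value at 1 is n. *)
Lemma prod_1sub_unity_roots n w :
  n.-primitive_root w -> \prod_(1 <= m < n) (1 - w ^+ m) = n%:R.
Proof.
move=> wn; have n0 := prim_order_gt0 wn.
have := factor_Xn_sub_1 wn; rewrite big_ltn // expr0 subrX1.
have X1 : ('X - 1 : {poly F}) != 0 by rewrite polyXsubC_eq0.
move=> /(mulfI X1)/(congr1 (fun p : {poly F} => p.[1])).
rewrite horner_prod horner_sum [X in _ = X](eq_bigr (fun=> 1)) => [|i _]; last first.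
  by rewrite hornerXn expr1n.
rewrite sumr_const card_ord => <-.
by apply: eq_bigr => m _; rewrite !hornerE.
Qed.

Lemma closed_field_quartic (a1 a2 a3 a4 : F) :
  exists b1 b2 b3 b4 : F,
  [/\ b1 + b2 + b3 + b4 = a1,
      b1 * b2 + b1 * b3 + b1 * b4 + b2 * b3 + b2 * b4 + b3 * b4 = a2,
      b1 * b2 * b3 + b1 * b2 * b4 + b1 * b3 * b4 + b2 * b3 * b4 = a3
    & b1 * b2 * b3 * b4 = a4].
Proof.
pose p : {poly F} := Poly [:: a4; - a3; a2; - a1; 1].
have sp : size p = 5%N by rewrite (@PolyK _ 0) //= oner_eq0.
have [r] := closed_field_poly_normal p.
rewrite lead_coefE sp coef_Poly /= scale1r => pr.
have : size r = 4%N.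
  by apply/eqP; rewrite -eqSS -(size_prod_XsubC r id) -pr sp.
move: r pr => [|b1 [|b2 [|b3 [|b4 [|]]]]] // pr _.
exists b1, b2, b3, b4.
have {}pr : p = \poly_(i < 5) nth 0 [:: b1 * b2 * b3 * b4;
    - (b1 * b2 * b3 + b1 * b2 * b4 + b1 * b3 * b4 + b2 * b3 * b4);
    b1 * b2 + b1 * b3 + b1 * b4 + b2 * b3 + b2 * b4 + b3 * b4;
    - (b1 + b2 + b3 + b4); 1] i.
  rewrite pr poly_def !big_ord_recl big_ord0 /= -!mul_polyC !big_cons big_nil.
  by rewrite !(rmorphD, rmorphN, rmorphM, rmorph1) /=; ring.
have pE i : p`_i = _ := congr1 (fun q : {poly F} => q`_i) pr.
have := (pE 3, pE 2, pE 1, pE 0); rewrite !coef_Poly !coef_poly /=.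
by case=> [[[/oppr_inj -> ->] /oppr_inj ->] ->].
Qed.

(** The root m = 0 contributes H(1) = y. Every other H(w^m) is (1 - w^m)^4 times a factor of the
    product, and these fourth powers multiply to n^4. *)
Lemma cyclotomic_product n w x y : n.-primitive_root w ->
  n%:R ^+ 4 * (y * \prod_(1 <= m < n) (1 + x * (w ^+ (2 * m) / (1 - w ^+ m) ^+ 3)
                                 + y * (w ^+ (3 * m) / (1 - w ^+ m) ^+ 4)))
  = n%:R * \sum_(i < n) (serP n x y ^+ i.+1 - serR n x y ^+ i.+1
                         - serT n x y ^+ i.+1)`_n / i.+1%:R.
Proof.
move=> wn; have n0 := prim_order_gt0 wn.
have [b1 [b2 [b3 [b4 [h1 h2 h3 h4]]]]] := closed_field_quartic (4 + x - y) (6 + x) 4 1.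
rewrite -(power_sum_roots n0 h1 h2 h3 h4).
have -> : (1 - b1 ^+ n) * (1 - b2 ^+ n) * (1 - b3 ^+ n) * (1 - b4 ^+ n) =
  (b1 ^+ n - 1) * (b2 ^+ n - 1) * (b3 ^+ n - 1) * (b4 ^+ n - 1) by ring.
rewrite -!(prod_sub_unity_roots _ wn) -!big_split /=.
rewrite -(prod_1sub_unity_roots wn) -prodrXl mulrCA -big_split /= [RHS]big_ltn //.
have hz z : (b1 - z) * (b2 - z) * (b3 - z) * (b4 - z) =
   (1 - z) ^+ 4 + x * (1 - z) * z ^+ 2 + y * z ^+ 3.
  have -> : y = 4 + x - (b1 + b2 + b3 + b4) by rewrite h1; ring.
  have -> : x = b1 * b2 + b1 * b3 + b1 * b4 + b2 * b3 + b2 * b4 + b3 * b4 - 6.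
    by rewrite h2; ring.
  have -> : (b1 - z) * (b2 - z) * (b3 - z) * (b4 - z) =
    b1 * b2 * b3 * b4
    - (b1 * b2 * b3 + b1 * b2 * b4 + b1 * b3 * b4 + b2 * b3 * b4) * z
    + (b1 * b2 + b1 * b3 + b1 * b4 + b2 * b3 + b2 * b4 + b3 * b4) * z ^+ 2
    - (b1 + b2 + b3 + b4) * z ^+ 3 + z ^+ 4 by ring.
  by rewrite h3 h4; ring.
congr (_ * _); first by rewrite hz expr0; ring.
apply: eq_big_nat => m /andP[m0 mn]; rewrite hz ![(_ * m)%N]mulnC !exprM.
have nz : 1 - w ^+ m != 0.
  by rewrite subr_eq0 eq_sym -(prim_order_dvd wn) gtnNdvd.
by field.
Qed.
End CyclotomicProduct.

(** * Coefficients of powers of the truncated geometric series *)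

Lemma coef_onesX (A : comNzRingType) n e i :
  (i <= n)%N -> (ones n.+1 ^+ e.+1 : {poly A})`_i = 'C(i + e, e)%:R.
Proof.
elim: e i => [|e IHe] i.
  move=> le_in; rewrite expr1 bin0 /ones coef_sum (bigD1 (Ordinal (le_in : i < n.+1)%N)) //=.
  rewrite coefXn eqxx big1 ?addr0 // => j; rewrite -val_eqE /= => ij.
  by rewrite coefXn eq_sym (negPf ij).
(* Up to degree n, multiplying by 1 - X lowers the exponent by one, so the coefficients obey
   Pascal's rule. *)
have rec j : (j <= n)%N ->
    ((1 - 'X) * ones n.+1 ^+ e.+2 : {poly A})`_j = 'C(j + e, e)%:R.
  move=> le_jn; rewrite exprS mulrA onesE mulrBl mul1r coefB coefXnM ltnS le_jn.
  by rewrite subr0 IHe.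
elim: i => [|i IHi] le_in.
  have := rec 0 isT; rewrite mulrBl mul1r coefB coefXM /= subr0 => ->.
  by rewrite !binn.
have := rec _ le_in; rewrite mulrBl mul1r coefB coefXM /= IHi ?(ltnW le_in) //.
by move/(canRL (subrK _)) => ->;
  rewrite -natrD [(i.+1 + e.+1)%N]addSn [in RHS]binS addSnnS addnC.
Qed.

(** For n < a both sides vanish, since then n + e - a < e. *)
Lemma coef_XnonesX (A : comNzRingType) n a e :
  (a <= e)%N -> ('X^a * ones n.+1 ^+ e.+1 : {poly A})`_n = 'C(n + e - a, e)%:R.
Proof.
move=> le_ae; rewrite coefXnM; case: ltnP => [lt_na|le_an].
  by rewrite bin_small // ltn_subLR ?ltn_add2r ?(leq_trans le_ae) ?leq_addl.
by rewrite coef_onesX ?leq_subr // addnBAC.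
Qed.

(** * Compatibility of the series with ring morphisms *)

Section SeriesMorphism.
Variables (A B : comNzRingType) (f : {rmorphism A -> B}).

Lemma map_ones n : map_poly f (ones n) = ones n.
Proof. by rewrite rmorph_sum; apply: eq_bigr => i _; rewrite /= map_polyXn. Qed.

Let mapE := (map_ones, map_polyXn, map_polyX, map_polyC).

Lemma map_serR n x y : map_poly f (serR n x y) = serR n (f x) (f y).
Proof.
by rewrite /serR !(rmorphXn, rmorphM, rmorphD) /= !mapE /= [f (- y)]rmorphN.
Qed.

Lemma map_serT n x y : map_poly f (serT n x y) = serT n (f x) (f y).
Proof.
rewrite /serT !(rmorphXn, rmorphM, rmorphD) /= !mapE /=.
by rewrite [f (- x)]rmorphN [f (- y)]rmorphN.
Qed.

Lemma map_serP n x y : map_poly f (serP n x y) = serP n (f x) (f y).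
Proof.
have fc : f (4 * y) = 4 * f y by rewrite rmorphM rmorph_nat.
have fd : f ((x - y) ^+ 2) = (f x - f y) ^+ 2 by rewrite rmorphXn rmorphB.
rewrite /serP -fc -fd; move: (4 * y) ((x - y) ^+ 2) => c d {fc fd}.
by rewrite !(rmorphXn, rmorphM, rmorphD) /= !mapE.
Qed.
End SeriesMorphism.

(** * The product identity in two indeterminates *)

Section BivariateCoefficients.
Variable F : numClosedFieldType.
Local Notation A := {poly {poly F}}.
Local Notation x := (('X : {poly F})%:P : A).
Local Notation y := ('X : A).

(* The variable [y] is the outer one, [x] the inner one. *)
Definition word_gf n (a b : nat -> F) : A :=
  \prod_(1 <= m < n) (1 + x * (a m)%:P%:P + y * (b m)%:P%:P).

(** By [cyclotomic_product] both sides agree at all values (u, v), which suffices by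
    [bipoly_eval_inj]. *)
Lemma word_gfE n w : n.-primitive_root w ->
  (n%:R ^+ 4)%:P%:P * (y * word_gf n (fun m => w ^+ (2 * m) / (1 - w ^+ m) ^+ 3)
                              (fun m => w ^+ (3 * m) / (1 - w ^+ m) ^+ 4))
  = n%:R%:P%:P * \sum_(i < n) (serP n x y ^+ i.+1 - serR n x y ^+ i.+1
                         - serT n x y ^+ i.+1)`_n * (i.+1%:R^-1)%:P%:P.
Proof.
move=> wn; apply: bipoly_eval_inj => u v.
pose phi : A -> F := horner_eval u \o horner_eval v%:P.
pose phi' : {rmorphism A -> F} := phi.
have phiE P : P.[v%:P].[u] = phi' P by [].
have phix : phi' x = u by rewrite -phiE !hornerE.
have phiy : phi' y = v by rewrite -phiE !hornerE.
have phiC c : phi' c%:P%:P = c by rewrite -phiE !hornerE.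
clearbody phi'; rewrite !phiE [LHS]rmorphM [RHS]rmorphM [phi' (y * _)]rmorphM !phiC phiy.
rewrite rmorph_prod rmorph_sum.
have e := cyclotomic_product u v wn.
under eq_bigr => m _ do rewrite !(rmorphD, rmorphM, rmorph1) phix phiy !phiC.
rewrite [LHS]e; congr (_ * _); apply: eq_bigr => i _.
by rewrite rmorphM phiC -coef_map !rmorphB !rmorphXn /= map_serP map_serR map_serT phix phiy.
Qed.

(** The coefficient N of [T] is free of x and y, so a single monomial survives. *)
Lemma coef_bimonomial (c : F) (T : {poly A}) n N a b m l :
  T`_n = N%:R ->
  ((c%:P%:P * (x ^+ a * y ^+ b))%:P * T)`_n`_m`_l
  = (if (a == l) && (b == m) then c * N%:R else 0).
Proof.
move=> TN; rewrite coefCM TN.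
have -> : c%:P%:P * (x ^+ a * y ^+ b) * N%:R = (c * N%:R)%:P%:P * x ^+ a * y ^+ b.
  by rewrite !rmorphM !rmorph_nat; ring.
rewrite coefMXn -polyC_exp -polyCM coefC subn_eq0.
have [lt_mb|lt_bm|eq_mb] := ltngtP m b; rewrite ?andbF ?coef0 //=.
by rewrite andbT coefCM coefXn eq_sym; case: eqP; rewrite ?mulr1 ?mulr0.
Qed.
End BivariateCoefficients.

(** For monomials other than the one sought, it is enough that this coefficient is some constant
    free of x and y. *)
Lemma coef_XnonesX_nat (A : comNzRingType) n a e :
  {N : nat | ('X^a * ones n.+1 ^+ e : {poly A})`_n = N%:R}.
Proof.
case: e => [|e]; first by rewrite expr0 mulr1 coefXn; exists (n == a).
rewrite coefXnM; case: ltnP => _; first by exists 0.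
by exists 'C(n - a + e, e); rewrite coef_onesX ?leq_subr.
Qed.

Lemma prod3_exprMn (A : comNzRingType) (X U c1 c2 c3 : A) g1 g2 g3 a1 a2 a3 p q r :
  (c1 * X ^+ g1 * U ^+ a1) ^+ p * (c2 * X ^+ g2 * U ^+ a2) ^+ q
    * (c3 * (X ^+ g3 * U ^+ a3) ^+ r)
  = (c1 ^+ p * c2 ^+ q * c3)
    * (X ^+ (g1 * p + g2 * q + g3 * r) * U ^+ (a1 * p + a2 * q + a3 * r)).
Proof. by rewrite !exprMn !exprD !exprM; ring. Qed.

(** * Coefficients of powers of the three series *)

Section CoefficientExtraction.
Variable F : numClosedFieldType.
Local Notation A := {poly {poly F}}.
Local Notation x := (('X : {poly F})%:P : A).
Local Notation y := ('X : A).

(** Serves both [serR] and [serT]. Each factor of the binomial expansion brings exactly one x or one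
    y, so x^l y^m forces i = l + m and the term of index m. *)
Lemma coef_ser2 n (c d : F) (g h a b i l m : nat) :
  (g * l + h * m < a * l + b * m)%N ->
  (((c%:P%:P * x)%:P * 'X^g * ones n.+1 ^+ a
     + (d%:P%:P * y)%:P * 'X^h * ones n.+1 ^+ b) ^+ i)`_n`_m`_l
  = (if i == (l + m)%N then
      c ^+ l * d ^+ m * 'C(l + m, m)%:R
      * 'C(n + (a * l + b * m).-1 - (g * l + h * m), (a * l + b * m).-1)%:R
     else 0) :> F.
Proof.
move=> ltgh; set u := _ * ones _ ^+ a; set v := _ * ones _ ^+ b.
have E p q : (u ^+ p * v ^+ q *+ 'C(i, q))`_n`_m`_l =
    (((c ^+ p * d ^+ q * 'C(i, q)%:R)%:P%:P * (x ^+ p * y ^+ q))%:P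
    * ('X^(g * p + h * q) * ones n.+1 ^+ (a * p + b * q)))`_n`_m`_l.
  congr ((_ : {poly A})`_n`_m`_l).
  rewrite -mulr_natr /u /v !exprMn -!polyC_exp !exprMn !exprD !exprM !polyCM !polyC_exp.
  by rewrite !polyC_natr; ring.
rewrite exprDn !coef_sum.
have [ei|ne_i] := eqVneq i (l + m)%N; last first.
  rewrite big1 // => j _; apply: etrans (E (i - j)%N j) _.
  have [N /coef_bimonomial ->] := coef_XnonesX_nat A n (g * (i - j) + h * j) (a * (i - j) + b * j).
  case: eqP => //= el; case: eqP => //= em.
  by case/eqP: ne_i; rewrite -el -em subnK // -ltnS.
have lt_m : (m < i.+1)%N by rewrite ltnS ei leq_addl.
rewrite (bigD1 (Ordinal lt_m)) //= big1 ?addr0 => [|j].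
  apply: etrans (E _ _) _; rewrite ei addnK.
  (* The hypothesis makes this exponent positive, so it is the successor that [coef_XnonesX]
     expects. *)
  have e0 : (a * l + b * m)%N = (a * l + b * m).-1.+1 by rewrite (ltn_predK ltgh).
  have le_e : (g * l + h * m <= (a * l + b * m).-1)%N by rewrite -ltnS -e0.
  rewrite [in ones _ ^+ _]e0.
  have := coef_bimonomial (c ^+ l * d ^+ m * 'C(l + m, m)%:R) l m m l
    (coef_XnonesX A n le_e).
  by rewrite !eqxx => ->.
rewrite -val_eqE /= => jm; apply: etrans (E (i - j)%N j) _.
have [N /coef_bimonomial ->] := coef_XnonesX_nat A n (g * (i - j) + h * j) (a * (i - j) + b * j).
by rewrite (negPf jm) andbF.
Qed.

Lemma coef_serR n i l m : (0 < m)%N ->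
  ((serR n x y ^+ i)`_n)`_m`_l
  = (if i == (l + m)%N then
      (-1) ^+ m * 'C(l + m, m)%:R
      * 'C(n + (3 * l + 4 * m).-1 - (l + m), (3 * l + 4 * m).-1)%:R
     else 0) :> F.
Proof.
move=> m0; have := @coef_ser2 n 1 (-1) 1 1 3 4 i l m.
by rewrite !rmorphN !rmorph1 mulN1r mul1r !mul1n expr1n mul1r; apply; lia.
Qed.

Lemma coef_serT n i l m : (0 < m)%N ->
  ((serT n x y ^+ i)`_n)`_m`_l
  = (if i == (l + m)%N then
      (-1) ^+ (l + m) * 'C(l + m, m)%:R
      * 'C(n + (3 * l + 4 * m).-1 - (2 * l + 3 * m), (3 * l + 4 * m).-1)%:R
     else 0) :> F.
Proof.
move=> m0; have := @coef_ser2 n (-1) (-1) 2 3 3 4 i l m.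
by rewrite !rmorphN !rmorph1 !mulN1r -exprD; apply; lia.
Qed.

(* [b] counts the factors [(x - y)^2 t^3 / (1 - t)^6] in the expansion of
   [serP ^+ i], and [j] the factors [4 y t^2 / (1 - t)^4]. *)
Definition pairs_coef n l m i : F :=
  let b := (l + m - i)%N in
  'C(i, b)%:R * \sum_(0 <= j < (i - b).+1)
     4 ^+ j * 'C(i - b, j)%:R
     * (if (j <= m)%N then (-1) ^+ (m - j) * 'C(2 * b, m - j)%:R else 0)
     * 'C(n + (4 * b + 2 * i + 2 * j).-1 - (2 * b + i + j), (4 * b + 2 * i + 2 * j).-1)%:R.

(** Let q be the degree in y taken from (x - y)^(2b). Total degrees give i + b = l + m and y-degrees
    give j + q = m, so b and q are determined and only the sum over j remains. *)
Lemma coef_serP n i l m : (0 < i)%N ->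
  ((serP n x y ^+ i)`_n)`_m`_l
  = (if (i <= l + m)%N then pairs_coef n l m i else 0) :> F.
Proof.
move=> i0; rewrite /serP.
set u := _ * ones _ ^+ 2; set v := _ * ones _ ^+ 4; set w := _ * ones _ ^+ 6.
have E b j q : (b <= i)%N -> (j <= i - b)%N -> (q <= 2 * b)%N ->
    (u ^+ (i - b - j) * v ^+ j *+ 'C(i - b, j) * ((x ^+ (2 * b - q) * (- y) ^+ q *+ 'C(2 * b, q))%:P
       * ('X^3 * ones n.+1 ^+ 6) ^+ b) *+ 'C(i, b))`_n`_m`_l
    = (if (i - b - j + (2 * b - q) == l)%N && (j + q == m)%N then
       ('C(i, b)%:R * 4 ^+ j * 'C(i - b, j)%:R * (-1) ^+ q * 'C(2 * b, q)%:R)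
       * 'C(n + (4 * b + 2 * i + 2 * j).-1 - (2 * b + i + j), (4 * b + 2 * i + 2 * j).-1)%:R
      else 0) :> F.
  move=> bi ji qb.
  have -> : u ^+ (i - b - j) * v ^+ j *+ 'C(i - b, j) * ((x ^+ (2 * b - q) * (- y) ^+ q *+ 'C(2 * b, q))%:P
       * ('X^3 * ones n.+1 ^+ 6) ^+ b) *+ 'C(i, b)
    = (('C(i, b)%:R * 4 ^+ j * 'C(i - b, j)%:R * (-1) ^+ q * 'C(2 * b, q)%:R)%:P%:P
       * (x ^+ (i - b - j + (2 * b - q)) * y ^+ (j + q)))%:P
      * ('X^(2 * b + i + j) * ones n.+1 ^+ (4 * b + 2 * i + 2 * j).-1.+1).
    (* Each of the three factors carries twice as many powers of [ones] as of X; the total 2 (2b + i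
       + j) is positive because i > 0. *)
    have -> : (4 * b + 2 * i + 2 * j).-1.+1 = (2 * (i - b - j) + 4 * j + 6 * b)%N by lia.
    have -> : (2 * b + i + j)%N = (1 * (i - b - j) + 2 * j + 3 * b)%N by lia.
    rewrite -[_ *+ 'C(i, b)]mulr_natr mulrnAl -[_ *+ 'C(i - b, j)]mulr_natr.
    rewrite (prod3_exprMn 'X (ones n.+1) x%:P (4 * y)%:P _ 1 2 3 2 4 6).
    move: ('X^(1 * _ + _ + _) * _) => T.
    rewrite -[_ *+ 'C(2 * b, q)]mulr_natr [(- y) ^+ q]exprNn exprD exprD.
    rewrite -!polyC_exp exprMn !polyCM !polyC_exp !polyC_natr !(polyCN, polyC1).
    by ring.
  have le_e : (2 * b + i + j <= (4 * b + 2 * i + 2 * j).-1)%N by lia.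
  have TN := coef_XnonesX A n le_e.
  exact: (coef_bimonomial _ _ _ _ _ TN).
have -> : (u + v + w) ^+ i = \sum_(b < i.+1) \sum_(j < (i - b).+1) \sum_(q < (2 * b).+1)
    (u ^+ (i - b - j) * v ^+ j *+ 'C(i - b, j)
     * ((x ^+ (2 * b - q) * (- y) ^+ q *+ 'C(2 * b, q))%:P
        * ('X^3 * ones n.+1 ^+ 6) ^+ b) *+ 'C(i, b)).
  rewrite exprDn; apply: eq_bigr => b _.
  rewrite exprDn mulr_suml -sumrMnl; apply: eq_bigr => j _.
  have -> : w ^+ b = (\sum_(q < (2 * b).+1) (x ^+ (2 * b - q) * (- y) ^+ q *+ 'C(2 * b, q))%:P)
      * ('X^3 * ones n.+1 ^+ 6) ^+ b.
    by rewrite /w -mulrA exprMn -polyC_exp -exprM exprDn rmorph_sum.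
  by rewrite mulr_suml mulr_sumr -sumrMnl.
pose f (b j q : nat) : F := if (i - b - j + (2 * b - q) == l)%N && (j + q == m)%N then
       ('C(i, b)%:R * 4 ^+ j * 'C(i - b, j)%:R * (-1) ^+ q * 'C(2 * b, q)%:R)
       * 'C(n + (4 * b + 2 * i + 2 * j).-1 - (2 * b + i + j), (4 * b + 2 * i + 2 * j).-1)%:R
      else 0.
transitivity (\sum_(b < i.+1) \sum_(j < (i - b).+1) \sum_(q < (2 * b).+1) f b j q).
  rewrite 3!coef_sum; apply: eq_bigr => b _.
  rewrite 3!coef_sum; apply: eq_bigr => j _.
  rewrite 3!coef_sum; apply: eq_bigr => q _.
  by apply: E; rewrite -ltnS.
rewrite {E u v w}; have [le_i|lt_i] := leqP i (l + m); last first.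
  rewrite big1 // => -[b /= bi] _; rewrite big1 // => -[j /= ji] _.
  rewrite big1 // => -[q /= qb] _; rewrite /f; case: ifP => // /andP[/eqP ? /eqP ?].
  by exfalso; lia.
rewrite /pairs_coef; set B := (l + m - i)%N.
have [le_B|lt_B] := leqP B i; last first.
  rewrite bin_small // mul0r big1 // => -[b /= bi] _; rewrite big1 // => -[j /= ji] _.
  rewrite big1 // => -[q /= qb] _; rewrite /f; case: ifP => // /andP[/eqP ? /eqP ?].
  by exfalso; rewrite /B in lt_B; lia.
rewrite (bigD1 (Ordinal (le_B : B < i.+1)%N)) //= [X in _ + X]big1 ?addr0; last first.
  move=> [b /= bi]; rewrite -val_eqE /= => /eqP bB.
  rewrite big1 // => -[j /= ji] _; rewrite big1 // => -[q /= qb] _.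
  rewrite /f; case: ifP => // /andP[/eqP ? /eqP ?].
  by exfalso; apply: bB; rewrite /B; lia.
rewrite big_mkord mulr_sumr; apply: eq_bigr => -[j /= ji] _.
(* No q fits when j > m or m - j > 2B; the guard, respectively the binomial, vanishes as well. *)
case: leqP => [le_jm|lt_mj]; last first.
  rewrite mulr0 mul0r mulr0 big1 // => -[q /= qb] _; rewrite /f.
  by case: ifP => // /andP[/eqP ? /eqP ?]; exfalso; lia.
have [le_mj|lt_mj] := leqP (m - j) (2 * B); last first.
  rewrite ['C(2 * B, _)]bin_small // !mulr0 mul0r mulr0 big1 // => -[q /= qb] _.
  by rewrite /f; case: ifP => // /andP[/eqP ? /eqP ?]; exfalso; lia.
rewrite (bigD1 (Ordinal (le_mj : m - j < (2 * B).+1)%N)) //= big1 ?addr0; last first.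
  move=> [q /= qb]; rewrite -val_eqE /= => /eqP qmj.
  rewrite /f; case: ifP => // /andP[/eqP ? /eqP ?].
  by exfalso; apply: qmj; lia.
rewrite /f ifT; first by ring.
by apply/andP; split; apply/eqP; rewrite /B; rewrite /B in le_B le_mj; lia.
Qed.
End CoefficientExtraction.

(** * Comparison with the closed formula *)

Section WordGF.
Variable F : numClosedFieldType.

(** Term by term in i: (-1)^(s+1-j) 4^j = (-1)^(s+1) (-4)^j, and the sign (-1)^(s+1) is (-1)^s times
    the minus of -(s+1) in [A]. *)
Lemma ratr_A n l s :
  (-1) ^+ s * 'C(s + l, l)%:R * ratr (A n l s)
  = s.+1%:R * \sum_(1 <= i < (s + l + 1).+1) pairs_coef F n l s.+1 i / i%:R.
Proof.
rewrite /A rmorph_sum /= !mulr_sumr; apply: eq_big_nat => i /andP[i0 le_i].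
have C0 : 'C(s + l, l)%:R != 0 :> F by rewrite pnatr_eq0 -lt0n bin_gt0 leq_addl.
have i0' : i%:R != 0 :> F by rewrite pnatr_eq0 -lt0n.
rewrite [(s + 1)%N]addn1 /pairs_coef natrM !rmorphM /= rmorphN fmorphV /= rmorphM /= !ratr_nat.
have -> : (s + l + 1 - i = l + s.+1 - i)%N by lia.
set B := (l + s.+1 - i)%N.
(* Since i - B stands for 2i - s - l - 1, the case i < B is the one where the inner sum of [A] is
   empty. *)
have [lt_iB|le_Bi] := ltnP i B; first by rewrite ['C(i, B)]bin_small // !(mul0r, mulr0).
have -> : (2 * i - (s + l) = (i - B).+1)%N by rewrite /B in le_Bi *; lia.
rewrite rmorph_sum /=.
have -> : \sum_(0 <= j < (i - B).+1) 4 ^+ j * 'C(i - B, j)%:R *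
    (if (j <= s.+1)%N then (-1) ^+ (s.+1 - j) * 'C(2 * B, s.+1 - j)%:R else 0) *
    'C(n + (4 * B + 2 * i + 2 * j).-1 - (2 * B + i + j), (4 * B + 2 * i + 2 * j).-1)%:R
  = (-1) ^+ s.+1 * \sum_(0 <= j < (i - B).+1) ratr ((-4) ^+ j * 'C(2 * i - s - l - 1, j)%:R
        * 'C(n + 2 * s + 2 * l + 1 - i + j,
             4 * s + 4 * l + 3 - 2 * i + 2 * j)%:R
        * (if (j <= s.+1)%N
           then 'C(2 * s + 2 * l + 2 - 2 * i, s.+1 - j)%:R else 0)) :> F.
  rewrite mulr_sumr; apply: eq_big_nat => j /andP[_ le_j].
  rewrite !rmorphM /= rmorphXn /= rmorphN /= !ratr_nat.
  case: (leqP j s.+1) => [le_js|_]; last by rewrite rmorph0 !(mulr0, mul0r).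
  have -> : (2 * s + 2 * l + 2 - 2 * i = 2 * B)%N by rewrite /B; lia.
  have -> : (2 * i - s - l - 1 = i - B)%N by rewrite /B in le_Bi *; lia.
  have -> : (4 * s + 4 * l + 3 - 2 * i + 2 * j = (4 * B + 2 * i + 2 * j).-1)%N.
    by rewrite /B; lia.
  have -> : (n + 2 * s + 2 * l + 1 - i + j
      = n + (4 * B + 2 * i + 2 * j).-1 - (2 * B + i + j))%N by rewrite /B; lia.
  rewrite ratr_nat [(-4) ^+ j]exprNn.
  have -> : (-1) ^+ s.+1 = (-1) ^+ (s.+1 - j) * (-1) ^+ j :> F by rewrite -exprD subnK.
  have e : (-1) ^+ j * (-1) ^+ j = 1 :> F by rewrite -exprMn mulrNN mulr1 expr1n.
  by ring: e.
rewrite exprS; set S := \sum_(_ <= _ < _) _; field.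
by rewrite i0' C0.
Qed.

(** Compares the coefficients of x^l y^(s+1) in [word_gfE], whose extra y shifts s to s + 1. [serP]
    yields the term with [A]; [serR] and [serT] contribute only through the power l + s + 1, which l
    + s < n keeps within the sum. *)
Lemma coef_word_gf n w l s : n.-primitive_root w -> (l + s < n)%N ->
  s.+1%:R * (word_gf n (fun m => w ^+ (2 * m) / (1 - w ^+ m) ^+ 3)
                       (fun m => w ^+ (3 * m) / (1 - w ^+ m) ^+ 4))`_s`_l
  = 'C(l + s, s)%:R * ((-1) ^+ s / n%:R ^+ 3 *
     ('C(n + (3 * l + 4 * s) - (l + s) + 2, (3 * l + 4 * s) + 3)%:R
      + (-1) ^+ l * 'C(n + (l + s), (3 * l + 4 * s) + 3)%:R + ratr (A n l s))) :> F.
Proof.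
move=> wn lt_n; have n0 : n%:R != 0 :> F by rewrite pnatr_eq0 -lt0n (prim_order_gt0 wn).
have := congr1 (fun p : {poly {poly F}} => p`_s.+1`_l) (word_gfE wn); cbv beta.
set g := word_gf _ _ _; rewrite !coefCM coefXM /=.
rewrite !coef_sum.
have E (i : 'I_n) : (((serP n ('X)%:P 'X ^+ i.+1 - serR n ('X)%:P 'X ^+ i.+1 - serT n ('X)%:P 'X ^+ i.+1)`_n
      * (i.+1%:R^-1)%:P%:P : {poly {poly F}})`_s.+1)`_l =
    (if (i.+1 <= l + s.+1)%N then pairs_coef F n l s.+1 i.+1 else 0) / i.+1%:R
    - (if i.+1 == (l + s.+1)%N then
        ((-1) ^+ s.+1 * 'C(l + s.+1, s.+1)%:R
         * ('C(n + (3 * l + 4 * s) - (l + s) + 2, (3 * l + 4 * s) + 3)%:R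
            + (-1) ^+ l * 'C(n + (l + s), (3 * l + 4 * s) + 3)%:R)) / (l + s.+1)%:R else 0).
  rewrite !coefMC !coefB coef_serP // coef_serR // coef_serT // !mulrBl.
  case: eqP => [->|_]; last by rewrite !mul0r !subr0.
  have -> : ((3 * l + 4 * s.+1).-1 = 3 * l + 4 * s + 3)%N by lia.
  have -> : (n + (3 * l + 4 * s + 3) - (l + s.+1) = n + (3 * l + 4 * s) - (l + s) + 2)%N by lia.
  have -> : (n + (3 * l + 4 * s + 3) - (2 * l + 3 * s.+1) = n + (l + s))%N by lia.
  by rewrite exprD; ring.
under eq_bigr => i _ do rewrite E.
rewrite sumrB.
have -> : \sum_(i < n) (if (i < l + s.+1)%N then pairs_coef F n l s.+1 i.+1 else 0) / i.+1%:R
    = \sum_(1 <= i < (s + l + 1).+1) pairs_coef F n l s.+1 i / i%:R :> F.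
  have -> : (s + l + 1 = l + s.+1)%N by lia.
  rewrite big_add1 /= big_mkord (big_ord_widen n (fun i => pairs_coef F n l s.+1 i.+1 / i.+1%:R)).
    by rewrite [RHS]big_mkcond; apply: eq_bigr => i _; case: ifP; rewrite ?mul0r.
  by rewrite addnS.
rewrite [X in _ - X](bigD1 (Ordinal lt_n)) //= [X in _ - (_ + X)]big1 ?addr0 => [|i]; last first.
  by rewrite -val_eqE /= addnS eqSS => /negPf ->.
rewrite [(l + s.+1)%N]addnS eqxx => h.
have hA := ratr_A n l s; set SP := \sum_(_ <= _ < _) _ in h hA.
(* This absorption identity trades the 1/(l + s + 1) of the logarithm for the factor s + 1. *)
have hC : (l + s).+1%:R * 'C(l + s, s)%:R = s.+1%:R * 'C((l + s).+1, s.+1)%:R :> F.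
  by rewrite -!natrM mul_bin_diag.
have eC : 'C(s + l, l) = 'C(l + s, s) by rewrite addnC -[RHS]bin_sub ?leq_addl // addnK.
rewrite eC in hA.
have ls0 : (l + s).+1%:R != 0 :> F by rewrite pnatr_eq0.
set T := _ + (-1) ^+ l * _ in h *.
have {}h : g`_s`_l = (SP - (-1) ^+ s.+1 * 'C((l + s).+1, s.+1)%:R * T / (l + s).+1%:R) / n%:R ^+ 3.
  have n4 : n%:R ^+ 4 != 0 :> F by rewrite expf_neq0.
  by apply: (mulfI n4); rewrite h; field; rewrite n0 -natrD -mulrS ls0.
have -> : 'C(l + s, s)%:R * ((-1) ^+ s / n%:R ^+ 3 * (T + ratr (A n l s)))
  = ((-1) ^+ s * T * 'C(l + s, s)%:R + (-1) ^+ s * 'C(l + s, s)%:R * ratr (A n l s)) / n%:R ^+ 3.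
  by ring.
rewrite hA h exprS.
have -> : 'C(l + s, s)%:R = s.+1%:R * 'C((l + s).+1, s.+1)%:R / (l + s).+1%:R :> F.
  by rewrite -hC; field; rewrite -natrD -mulrS ls0.
by field; rewrite n0 -natrD -mulrS ls0.
Qed.
End WordGF.

(** * Finite multiple harmonic q-series as nested sums *)

Lemma big_tcons (R : Type) (idx : R) (op : Monoid.com_law idx) (T : finType) d
    (P : pred (d.+1.-tuple T)) (G : d.+1.-tuple T -> R) :
  \big[op/idx]_(t | P t) G t
  = \big[op/idx]_(x : T) \big[op/idx]_(t : d.-tuple T | P (cons_tuple x t)) G (cons_tuple x t).
Proof.
rewrite (pair_big_dep xpredT (fun x t => P (cons_tuple x t)) (fun x t => G (cons_tuple x t))) /=.
rewrite (reindex (fun p : T * d.-tuple T => cons_tuple p.1 p.2)) //=.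
exists (fun t => (thead t, behead_tuple t)) => [[x t] _|t _] /=.
  by congr (_, _); apply: val_inj.
by rewrite [RHS]tuple_eta; apply: val_inj.
Qed.

Section NestedSums.
Variables (F : fieldType) (q : F).

Definition zterm k m : F := q ^+ (k.-1 * m) / qint q m ^+ k.

(** Recursion on the largest summation index. The base value is 0 at n = 0, which discards the terms
    whose last index is 0. *)
Fixpoint nested_sum n ks : F :=
  if ks is k :: ks' then \sum_(i < n) zterm k i * nested_sum i ks' else (0 < n)%:R.

(** The range N of the tuples is kept apart from the bound n, so that the induction lowers the bound
    while N stays fixed. *)
Lemma nested_sumE N n ks : (n <= N)%N ->
  \sum_(m : (size ks).-tuple 'I_N | path gtn n (rcons [seq val x | x <- m] 0%N))
    \prod_(i < size ks) zterm (nth 0%N ks i) (tnth m i) = nested_sum n ks.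
Proof.
elim: ks n => [|k ks IHks] n le_nN.
  rewrite big_mkcond (big_pred1 [tuple]) => [|t]; last by rewrite [t]tuple0 /= eqxx.
  by rewrite big_ord0 /= andbT; case: ifP.
rewrite big_tcons /= (big_ord_widen N (fun i => zterm k i * nested_sum i ks)) //.
rewrite [RHS]big_mkcond; apply: eq_bigr => x _ /=.
case: ltnP => lt_xn; last by rewrite big_pred0.
rewrite -(IHks _ (ltnW (ltn_ord x))) mulr_sumr; apply: eq_bigr => t _.
by rewrite big_ord_recl tnth0; congr (_ * _); apply: eq_bigr => i _; rewrite tnthS.
Qed.

Lemma zqE n ks : zq n ks q = nested_sum n ks.
Proof. exact: nested_sumE. Qed.

Lemma nested_sum_cons n k ks :
  nested_sum n.+1 (k :: ks) = nested_sum n (k :: ks) + zterm k n * nested_sum n ks.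
Proof. exact: big_ord_recr. Qed.

Lemma nested_sum0 ks : nested_sum 0 ks = 0.
Proof. by case: ks => //= *; rewrite big_ord0. Qed.
End NestedSums.

(** * Compositions, their words and their rotations *)

Definition incr_head (c : seq nat) := (head 0%N c).+1 :: behead c.

(* The recursion splits on whether the first entry is 0, that is, on whether the
   word [comp_index r c] below starts with [r + 1] or with [r]. *)
Fixpoint comps l : nat -> seq (seq nat) := fix comps_l s :=
  (if s is s'.+1 then [seq 0%N :: c | c <- comps_l s']
   else if l is 0 then [:: [:: 0%N]] else [::])
  ++ (if l is l'.+1 then [seq incr_head c | c <- comps l' s] else [::]).

Lemma comps00 : comps 0 0 = [:: [:: 0%N]]. Proof. by []. Qed.
Lemma comps0S s : comps 0 s.+1 = [seq 0%N :: c | c <- comps 0 s].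
Proof. by rewrite /= cats0. Qed.
Lemma compsS0 l : comps l.+1 0 = [seq incr_head c | c <- comps l 0].
Proof. by []. Qed.
Lemma compsSS l s : comps l.+1 s.+1
  = [seq 0%N :: c | c <- comps l.+1 s] ++ [seq incr_head c | c <- comps l s.+1].
Proof. by []. Qed.

Arguments comps : simpl never.

Lemma mem_comps l s c : (c \in comps l s) = (size c == s.+1) && (sumn c == l).
Proof.
have mem0 (c' : seq nat) cs : (c' \in [seq 0%N :: c | c <- cs]) =
   if c' is 0 :: c'' then c'' \in cs else false.
  apply/mapP/idP => [[c'' hc ->] //|].
  by case: c' => [|[|d] c''] // hc; exists c''.
have memS (c' : seq nat) l' s' : (forall c, (c \in comps l' s') = (size c == s'.+1) && (sumn c == l')) ->
   (c' \in [seq incr_head c | c <- comps l' s']) =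
   if c' is d.+1 :: c'' then d :: c'' \in comps l' s' else false.
  move=> IH; apply/mapP/idP => [[c'' hc ->]|].
    by move: hc; rewrite /incr_head; case: c'' => //; rewrite IH.
  by case: c' => [|[|d] c''] // hc; exists (d :: c'').
elim: l s c => [|l IHl] s; elim: s => [|s IHs] c.
- by rewrite comps00 inE; case: c => [|[|d] [|e c]] //; rewrite ?andbF //= addSn andbF.
- by rewrite comps0S mem0; case: c => [|[|d] c] //; rewrite ?IHs ?add0n //= addSn andbF.
- rewrite compsS0 (memS _ _ _ (IHl 0)); case: c => [|[|d] c] //.
  by case: c.
- rewrite compsSS mem_cat mem0 (memS _ _ _ (IHl _)); case: c => [|[|d] c] //.
    by rewrite orbF IHs /= add0n.
  by rewrite IHl.
Qed.

Lemma uniq_comps l s : uniq (comps l s).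
Proof.
have uniqS l' s' : uniq (comps l' s') -> uniq [seq incr_head c | c <- comps l' s'].
  move=> u; rewrite map_inj_in_uniq // => -[|d c] [|d' c']; rewrite !mem_comps //.
  by move=> _ _ [-> ->].
have uniq0 (cs : seq (seq nat)) : uniq cs -> uniq [seq 0%N :: c | c <- cs].
  by move=> u; rewrite map_inj_uniq // => ? ? [].
elim: l s => [|l IHl]; elim=> [|s IHs] //.
- by rewrite comps0S uniq0.
- by rewrite compsS0 uniqS.
- rewrite compsSS cat_uniq uniq0 // uniqS // andbT.
  by apply/hasPn => c /mapP[c' _ ->]; apply/mapP => -[].
Qed.

(** The two branches of [comps] are the two terms of Pascal's rule. *)
Lemma size_comps l s : size (comps l s) = 'C(l + s, s).
Proof.
elim: l s => [|l IHl]; elim=> [|s IHs] //.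
- by rewrite comps0S size_map IHs !add0n !binn.
- by rewrite compsS0 size_map IHl !bin0.
- by rewrite compsSS size_cat !size_map IHs IHl addSnnS [(l.+1 + s.+1)%N]addSn binS addnC.
Qed.

(** Rotation is injective and preserves length and sum. *)
Lemma perm_rot_comps l s j : perm_eq [seq rot j c | c <- comps l s] (comps l s).
Proof.
apply: uniq_perm; rewrite ?uniq_comps //.
  by rewrite map_inj_uniq ?uniq_comps //; apply: rot_inj.
move=> c; apply/mapP/idP => [[c' + ->]|hc].
  by rewrite !mem_comps size_rot /rot sumn_cat addnC -sumn_cat cat_take_drop.
exists (rotr j c); last by rewrite rotrK.
rewrite mem_comps size_rotr /rotr /rot sumn_cat addnC -sumn_cat cat_take_drop.
by rewrite -mem_comps.
Qed.

(** The index word of the term j = 0 of a cyclic sum, read off a list; term j is the word of the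
    list rotated by j. *)
Definition comp_index r (c : seq nat) : seq nat :=
  nseq (head 0%N c) r ++ flatten [seq r.+1 :: nseq d r | d <- behead c].

Lemma comp_index_cons0 r d c : comp_index r (0%N :: d :: c) = r.+1 :: comp_index r (d :: c).
Proof. by []. Qed.

Lemma comp_index_incr r c : comp_index r (incr_head c) = r :: comp_index r c.
Proof. by []. Qed.

Lemma cyc_index_rot r s c (j : 'I_s.+1) : size c = s.+1 ->
  cyc_index r (fun i : 'I_s.+1 => nth 0%N c i) j = comp_index r (rot j c).
Proof.
move=> sc.
have -> : rot j c = mkseq (fun i => nth 0%N c ((j + i) %% s.+1)) s.+1.
  apply: (@eq_from_nth _ 0%N) => [|i]; rewrite size_rot ?size_mkseq sc // => lt_i.
  rewrite nth_mkseq // /rot nth_cat size_drop sc nth_drop.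
  have lt_j := ltn_ord j.
  case: ltnP => [lt_ij|le_ji].
    by rewrite modn_small //; lia.
  rewrite nth_take; last by lia.
  have -> : (j + i)%N = (i - (s.+1 - j) + s.+1)%N by lia.
  by rewrite modnDr modn_small //; lia.
rewrite /comp_index /mkseq /= addn0 modn_small ?ltn_ord // /cyc_index.
congr (_ ++ flatten _); rewrite -[in RHS]map_comp; apply: eq_map => i /=.
by rewrite modnDmr.
Qed.

(** * Recursion in n for the sum over all words *)

Section CompositionSums.
Variables (F : numClosedFieldType) (q : F).

Definition comps_sum n l s : F := \sum_(c <- comps l s) nested_sum q n (comp_index 3 c).

(** Raising the bound to n + 1 adds the terms whose largest index is n; removing the first letter
    leaves a word with one 3 or one 4 fewer. The last summand is the jump of the empty word from 0
    to 1 at n = 0. *)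
Lemma comps_sum_rec n l s :
  comps_sum n.+1 l s = comps_sum n l s
    + (if l is l'.+1 then zterm q 3 n * comps_sum n l' s else 0)
    + (if s is s'.+1 then zterm q 4 n * comps_sum n l s' else 0)
    + (if (l == 0%N) && (s == 0%N) && (n == 0%N) then 1 else 0).
Proof.
have sum0 l' s' m : \sum_(c <- [seq 0%N :: c | c <- comps l' s']) nested_sum q m.+1 (comp_index 3 c)
   = \sum_(c <- [seq 0%N :: c | c <- comps l' s']) nested_sum q m (comp_index 3 c)
     + zterm q 4 m * comps_sum m l' s'.
  rewrite !big_map mulr_sumr -big_split; apply: eq_big_seq => c.
  rewrite mem_comps => /andP[sc _]; case: c sc => // d c _.
  by rewrite comp_index_cons0 nested_sum_cons.
have sumS l' s' m : \sum_(c <- [seq incr_head c | c <- comps l' s']) nested_sum q m.+1 (comp_index 3 c)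
   = \sum_(c <- [seq incr_head c | c <- comps l' s']) nested_sum q m (comp_index 3 c)
     + zterm q 3 m * comps_sum m l' s'.
  rewrite !big_map mulr_sumr -big_split; apply: eq_bigr => c _.
  by rewrite comp_index_incr nested_sum_cons.
rewrite {1 2}/comps_sum; case: l s => [|l] [|s].
- by rewrite comps00 !big_seq1 /= !addr0; case: n => [|n]; rewrite ?add0r ?addr0.
- by rewrite comps0S sum0 !addr0.
- by rewrite compsS0 sumS !addr0.
- rewrite compsSS !big_cat /= sum0 sumS !addr0; ring.
Qed.

(** The summand of z_n stripped of its power of 1 - q; these powers are collected as (1 - q)^(3l +
    4s). *)
Definition gf_term3 m := q ^+ (2 * m) / (1 - q ^+ m) ^+ 3.
Definition gf_term4 m := q ^+ (3 * m) / (1 - q ^+ m) ^+ 4.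

Lemma zterm3E m : zterm q 3 m = (1 - q) ^+ 3 * gf_term3 m.
Proof. by rewrite /zterm /gf_term3 /qint expr_div_n invf_div mulrCA. Qed.

Lemma zterm4E m : zterm q 4 m = (1 - q) ^+ 4 * gf_term4 m.
Proof. by rewrite /zterm /gf_term4 /qint expr_div_n invf_div mulrCA. Qed.

Lemma coef_word_gfS n l s : (0 < n)%N ->
  (word_gf n.+1 gf_term3 gf_term4)`_s`_l
  = (word_gf n gf_term3 gf_term4)`_s`_l
    + (if l is l'.+1 then gf_term3 n * (word_gf n gf_term3 gf_term4)`_s`_l' else 0)
    + (if s is s'.+1 then gf_term4 n * (word_gf n gf_term3 gf_term4)`_s'`_l else 0).
Proof.
move=> n0; rewrite {1}/word_gf big_nat_recr //= -/(word_gf n gf_term3 gf_term4).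
set g := word_gf n _ _.
have -> : g * (1 + ('X)%:P * (gf_term3 n)%:P%:P + 'X * (gf_term4 n)%:P%:P)
  = g + (gf_term3 n)%:P%:P * (g * ('X)%:P) + (gf_term4 n)%:P%:P * (g * 'X) by ring.
rewrite !coefD !coefCM coefMC !coefMX.
congr (_ + _ + _); first by case: (l) => [|l']; rewrite ?mulr0.
by case: (s) => [|s'] /=; rewrite ?coef0 ?mulr0.
Qed.

(** Both sides satisfy the same recursion in n; at n = 1 only the empty word, l = s = 0,
    contributes. *)
Lemma comps_sumE n l s : (0 < n)%N ->
  comps_sum n l s = (1 - q) ^+ (3 * l + 4 * s) * (word_gf n gf_term3 gf_term4)`_s`_l.
Proof.
elim: n l s => // -[_|n IHn] l s _.
  rewrite comps_sum_rec /word_gf big_geq // coef1.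
  have c0 l' s' : comps_sum 0 l' s' = 0.
    by rewrite /comps_sum big1 // => c _; rewrite nested_sum0.
  case: l s => [|l] [|s]; rewrite !c0 ?mulr0 /= ?coefC ?coef1 ?coef0 ?add0r ?mulr0 //.
  by rewrite expr0 mulr1.
rewrite comps_sum_rec coef_word_gfS // IHn // andbF addr0 !mulrDr.
congr (_ + _ + _).
  case: l => [|l]; first by rewrite mulr0.
  rewrite IHn // zterm3E; have -> : (3 * l.+1 + 4 * s = 3 + (3 * l + 4 * s))%N by lia.
  by rewrite [_ ^+ (3 + _)]exprD; ring.
case: s => [|s]; first by rewrite mulr0.
rewrite IHn // zterm4E; have -> : (3 * l + 4 * s.+1 = 4 + (3 * l + 4 * s))%N by lia.
by rewrite [_ ^+ (4 + _)]exprD; ring.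
Qed.
End CompositionSums.

(** * Averaging over compositions, and the equivalence *)

Lemma sum_cyclic_sum (F : numClosedFieldType) (q : F) n l s :
  \sum_(c <- comps l s) cyclic_sum 3 n (fun i : 'I_s.+1 => nth 0%N c i) q
  = s.+1%:R * comps_sum q n l s.
Proof.
(* After exchanging the sums, every rotation j gives the same total because it permutes
   [comps l s]. *)
rewrite /cyclic_sum exchange_big /= (eq_bigr (fun=> comps_sum q n l s)) => [|j _].
  by rewrite sumr_const card_ord mulr_natl.
rewrite /comps_sum -[RHS](perm_big _ (perm_rot_comps l s j)) big_map.
apply: eq_big_seq => c; rewrite mem_comps => /andP[/eqP sc _].
by rewrite zqE cyc_index_rot.
Qed.

Theorem corollary1p6 (R : realType) (n k s : nat) (zeta : R[i]) :
  (0 < n)%N -> (k < n)%N -> n.-primitive_root zeta ->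
  (forall d_ : 'I_s.+1 -> nat,
     (3 * (\sum_(j < s.+1) d_ j) + 4 * s = k)%N ->
     let d := (\sum_(j < s.+1) d_ j + s)%N in
     cyclic_sum 3 n d_ zeta =
       (-1) ^+ s / n%:R ^+ 3
       * ('C(n + k - d + 2, k + 3)%:R + (-1) ^+ (d - s) * 'C(n + d, k + 3)%:R
          + ratr (A n (d - s) s))
       * (1 - zeta) ^+ k)
  <->
  (forall d_ d'_ : 'I_s.+1 -> nat,
     (3 * (\sum_(j < s.+1) d_ j) + 4 * s = k)%N ->
     (3 * (\sum_(j < s.+1) d'_ j) + 4 * s = k)%N ->
     cyclic_sum 3 n d_ zeta = cyclic_sum 3 n d'_ zeta).
Proof.
move=> n0 lt_kn prim; split=> [formula d_ d'_ sum_d sum_d'|const d_ sum_d d].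
  (* The formula depends on the d_j only through their sum, which k and s fix. *)
  have eq_sum : (\sum_(j < s.+1) d_ j = \sum_(j < s.+1) d'_ j)%N by lia.
  by rewrite (formula _ sum_d) (formula _ sum_d') /= eq_sum.
rewrite {}/d addnK; set l := (\sum_(j < s.+1) d_ j)%N in sum_d *.
have C0 : 'C(l + s, s)%:R != 0 :> R[i].
  by rewrite pnatr_eq0 -lt0n bin_gt0 leq_addl.
(* By constancy all C(l + s, s) compositions of l give the same cyclic sum, so the total is that
   many copies of it. *)
have : 'C(l + s, s)%:R * cyclic_sum 3 n d_ zeta = s.+1%:R * comps_sum zeta n l s.
  rewrite -sum_cyclic_sum (eq_big_seq (fun=> cyclic_sum 3 n d_ zeta)) => [|c].
    by rewrite big_const_seq count_predT iter_addr addr0 size_comps mulr_natl.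
  rewrite mem_comps => /andP[/eqP sc /eqP cl]; apply: const => //.
  by rewrite -[RHS]sum_d -cl sumnE (big_nth 0%N) sc big_mkord.
(* The bound l + s < n comes from l + s <= 3l + 4s = k < n. *)
rewrite comps_sumE // mulrCA coef_word_gf //; last by lia.
rewrite sum_d mulrCA => /(mulfI C0) ->.
by rewrite mulrC.
Qed.
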